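(* Let $$h(r)=\begin{cases}0,&0\le r\le 1,\\ \tfrac12(\log r)^{3/2},& r>1.\end{cases}$$ Let $R_{-1}=0$ and $R_m=\exp\left[\tfrac49(2m+3)^2\right]$ for $m\in\mathbb{N}_0$, and define the bounded radial function $\varphi$ on $\mathbb{C}$ by $\varphi(z)=(-1)^m$ whenever $R_{m-1}\le|z|<R_m$, $m\in\mathbb{N}_0$. Then the eigenvalues $\lambda_{\varphi,m}$ of the Toeplitz operator $T_\varphi$ on $\mathcal{A}_h(\mathbb{C})$ satisfy $$\lim_{m\to\infty}\left|\lambda_{\varphi,m}-(-1)^m\right|=0.$$
   Context: $\mathbb{N}_0=\{0,1,2,\dots\}$. Put $h(z):=h(|z|)$ for $z\in\mathbb{C}$. $L^2_h(\mathbb{C})$ is the Hilbert space of measurable functions with $\|f\|_h^2=\int_{\mathbb{C}}|f(z)|^2e^{-2h(z)}\,dz<\infty$ ($dz$ Lebesgue measure), $\mathcal{A}_h(\mathbb{C})$ is its closed subspace of entire functions, $P:L_h^2(\mathbb{C})\to\mathcal{A}_h(\mathbb{C})$ is the orthogonal projection, and $T_\varphi f=P(\varphi f)$ for $\varphi\in L^\infty(\mathbb{C})$. For radial bounded $\varphi$ (so that $\varphi(z)=\varphi(|z|)$), $T_\varphi$ acts on $P^m(\mathbb{C})=\mathbb{C}z^m$ as the scalar $$\lambda_{\varphi,m}=\frac{\int_0^\infty \varphi(u)\,u^{2m+1}e^{-2h(u)}\,du}{\int_0^\infty u^{2m+1}e^{-2h(u)}\,du},\qquad m\in\mathbb{N}_0.$$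 *)

(* Defs.v *)
From HB Require Import structures.
From mathcomp Require Import all_boot all_order all_algebra.
From mathcomp Require Import complex.
From mathcomp Require Import all_classical all_reals all_analysis.

Set Implicit Arguments.
Unset Strict Implicit.
Unset Printing Implicit Defensive.

Import Order.TTheory GRing.Theory Num.Theory.
Import numFieldNormedType.Exports.
Import ComplexField.Normc.

Local Open Scope classical_set_scope.
Local Open Scope ring_scope.
Local Open Scope complex_scope.

Section complex_integration.
Context {R : realType}.

Definition cintegral d (T : measurableType d)
    (mu : {measure set T -> \bar R}) (D : set T) (F : T -> R[i]) : R[i] :=
  (\int[mu]_(x in D) complex.Re (F x)) +i* (\int[mu]_(x in D) complex.Im (F x)).

(* Functions on the complex plane are measured and integrated through the
   identification (x, y) |-> x + i y of R * R with R[i]. *)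
Local Notation plane := (measurableTypeR R * measurableTypeR R)%type.

Definition onplane (T : Type) (f : R[i] -> T) : plane -> T :=
  fun p => f (p.1 +i* p.2).

Definition area : {measure set plane -> \bar R} :=
  [the {measure set (measurableTypeR R * measurableTypeR R) -> \bar R} of
     (@lebesgue_measure R \x @lebesgue_measure R)%E].

Definition measurable_cfun (f : R[i] -> R[i]) : Prop :=
  measurable_fun setT (onplane (fun z => complex.Re (f z))) /\
  measurable_fun setT (onplane (fun z => complex.Im (f z))).

End complex_integration.

Section toeplitz.
Context {R : realType}.
Context (h : R -> R).

Definition weight (z : R[i]) : R := expR (- (2 * h (normc z))).

Definition L2h (f : R[i] -> R[i]) : Prop :=
  measurable_cfun f /\
  (\int[area]_p (onplane (fun z => normc (f z) ^+ 2 * weight z) p)%:E < +oo)%E.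

Definition inner_h (f g : R[i] -> R[i]) : R[i] :=
  cintegral area setT (onplane (fun z => f z * (g z)^* * (weight z)%:C)).

(* The base field of the derivative is R[i], so this is complex
   differentiability at every point. *)
Definition entire (f : R[i] -> R[i]) : Prop :=
  forall z : R[i], derivable (f : R[i]^o -> R[i]^o) z 1.

Definition Ah (f : R[i] -> R[i]) : Prop := entire f /\ L2h f.

(* The orthogonal projection of L2h onto Ah is represented by its graph.
   Elements of L2h are functions, not classes modulo null sets; an element of
   Ah, being continuous, is determined by its class. *)
Definition proj_Ah (f g : R[i] -> R[i]) : Prop :=
  [/\ L2h f, Ah g & forall k, Ah k -> inner_h (fun z => f z - g z) k = 0].

(* g = T_phi f *)
Definition toeplitz (phi f g : R[i] -> R[i]) : Prop :=
  Ah f /\ proj_Ah (fun z => phi z * f z) g.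

Definition monomials (m : nat) : set (R[i] -> R[i]) :=
  [set f | exists a : R[i], f = fun z => a * z ^+ m].

Definition toeplitz_scalar (phi : R[i] -> R[i]) (m : nat) (c : R[i]) : Prop :=
  forall f, monomials m f -> toeplitz phi f (fun z => c * f z).

Definition lambda (phi : R[i] -> R[i]) (m : nat) : R[i] :=
  cintegral (@lebesgue_measure R) `[0, +oo[
    (fun u : R => phi u%:C * (u ^+ (2 * m + 1) * expR (- (2 * h u)))%:C) /
  (\int[@lebesgue_measure R]_(u in `[0, +oo[)
    (u ^+ (2 * m + 1) * expR (- (2 * h u))))%:C.

End toeplitz.

Section example.
Context {R : realType}.

Definition h (r : R) : R := if r <= 1 then 0 else 2^-1 * ln r `^ (3 / 2).

Definition Rad (m : nat) : R := expR (4 / 9 * (2 * m + 3)%:R ^+ 2).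

(* R_{m-1}, with the convention R_{-1} = 0 *)
Definition Rad_prev (m : nat) : R := if m is k.+1 then Rad k else 0.

(* The intervals [R_{m-1}, R_m[ partition [0, +oo[, so that the index m
   selected by get is the only one; see phiE below. *)
Definition phi (z : R[i]) : R[i] :=
  (-1) ^+ get [set m : nat | Rad_prev m <= normc z < Rad m].

Lemma Rad_lt m n : (m < n)%N -> Rad m < Rad n.
Proof.
move=> mn; rewrite /Rad ltr_expR ltr_pM2l ?divr_gt0 ?ltr0n//.
by rewrite ltr_pXn2r ?nnegrE ?ler0n// ltr_nat ltn_add2r ltn_pmul2l.
Qed.

Lemma Rad_le_prev m n : (m < n)%N -> Rad m <= Rad_prev n.
Proof.
case: n => // n; rewrite ltnS leq_eqVlt => /orP[/eqP->//|mn].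
exact/ltW/Rad_lt.
Qed.

Lemma phiE m z : Rad_prev m <= normc z < Rad m -> phi z = (-1) ^+ m.
Proof.
move=> zm; rewrite /phi; congr (_ ^+ _).
have : [set m | Rad_prev m <= normc z < Rad m] m by [].
move=> /getI /=; set n := get _ => zn.
case/andP: zm => m1 m2; case/andP: zn => n1 n2.
case: (ltngtP n m) => // lt.
- by have := lt_le_trans n2 (le_trans (Rad_le_prev lt) m1); rewrite ltxx.
- by have := lt_le_trans m2 (le_trans (Rad_le_prev lt) n1); rewrite ltxx.
Qed.

End example.

(* Main.v *)
(* On the logarithmic scale t = log u the weight u^k e^{-2h(u)}, together with
   the p-homogeneous measure (k + p = 2m + 2 =: q), has density
   exp(q t - t^(3/2)), which peaks at t = 4/9 q^2, well inside the window
   [4/9 (q-1)^2, 4/9 (q+1)^2] on which phi = (-1)^m. For u outside that window,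
   a dilation c = e^a towards the peak gives
     u^k e^{-2h(u)} <= eps_m * c^p * (c u)^k e^{-2h(c u)},
   with eps_m decaying exponentially in m. Since the dilated weight has the same
   integral, the part of the mass outside the window is at most 2 eps_m times
   the total mass, so the phi-average is within 4 eps_m of (-1)^m.
   Only the homogeneity of the measure is used: it applies to the line (p = 1),
   which gives lambda, and to the plane (p = 2), where testing
   T_phi z^m = c z^m against z^m expresses c as such an average, without passing
   to polar coordinates. *)
Require Import Defs.
From HB Require Import structures.
From mathcomp Require Import all_boot all_order all_algebra.
From mathcomp Require Import complex.
From mathcomp Require Import all_classical all_reals all_analysis.
From mathcomp Require Import measurable_realfun.
From mathcomp Require Import ring lra.
Import Order.TTheory GRing.Theory Num.Theory.
Import numFieldNormedType.Exports.
Import ComplexField.Normc.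
Local Open Scope classical_set_scope.
Local Open Scope ring_scope.

(** * The density on the logarithmic scale and its decay away from the peak *)

Section radial_weight.
Context {R : realType}.
Implicit Types (t a b u : R) (k p m : nat).

(* [Num.sqrt] vanishes on negative numbers, so this covers both branches of
   [h]. *)
Lemma h_expR t : 2 * h (expR t) = Num.sqrt t ^+ 3.
Proof.
rewrite /h -[X in _ <= X]expR0 ler_expR; have [t0|t0] := leP t 0.
  by rewrite mulr0 ler0_sqrtr// expr0n.
rewrite expRK mulrA divff ?pnatr_eq0// mul1r.
by rewrite (mulrC (3 : R)) powRrM powR12_sqrt ?ltW// powR_mulrn ?sqrtr_ge0.
Qed.

(** [Num.sqrt t ^+ 2] is the positive part of [t], which grows at most as fast as [t]. *)
Lemma sqr_sqrtrD t a : 0 <= a -> Num.sqrt (t + a) ^+ 2 <= Num.sqrt t ^+ 2 + a.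
Proof.
move=> a0; have [t0|t0] := leP 0 t; first by rewrite !sqr_sqrtr// addr_ge0.
rewrite (ler0_sqrtr (ltW t0)) expr0n/= add0r.
have [ta|ta] := leP 0 (t + a); first by rewrite sqr_sqrtr//; lra.
by rewrite (ler0_sqrtr (ltW ta)) expr0n.
Qed.

(* Convexity of [t^(3/2)], whose derivative is [3/2 * sqrt t]. *)
Lemma sqrtr_cube_leD t a b : 0 <= a -> 0 <= b -> t + a <= b ^+ 2 ->
  Num.sqrt (t + a) ^+ 3 - Num.sqrt t ^+ 3 <= 3 / 2 * a * b.
Proof.
move=> a0 b0 tab; have := sqr_sqrtrD t _ a0.
have rb : Num.sqrt (t + a) <= b by rewrite -(ger0_norm b0) -sqrtr_sqr ler_wsqrtr.
have : Num.sqrt t <= Num.sqrt (t + a) by rewrite ler_wsqrtr// lerDl.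
move: rb (sqrtr_ge0 t); set r := Num.sqrt _; set s := Num.sqrt _.
move=> rb s0 sr rsa; have r0 : 0 <= r by exact: le_trans sr.
(* Tangent to [x^(3/2)] at [x = r^2]; the convexity defect is an explicit nonnegative remainder. *)
have -> : r ^+ 3 - s ^+ 3 =
  3 / 2 * r * (r ^+ 2 - s ^+ 2) - (r - s) ^+ 2 * (r / 2 + s) by field.
have : 0 <= (r - s) ^+ 2 * (r / 2 + s).
  by rewrite mulr_ge0 ?sqr_ge0// addr_ge0// divr_ge0.
have : r * (r ^+ 2 - s ^+ 2) <= b * a.
  by rewrite ler_pM// ?subr_ge0 ?ler_pXn2r ?nnegrE//; lra.
by rewrite -!mulrA (mulrC a); lra.
Qed.

Lemma sqrtr_cube_geD t a b : 0 <= a -> 0 <= b -> b ^+ 2 <= t ->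
  3 / 2 * a * b <= Num.sqrt (t + a) ^+ 3 - Num.sqrt t ^+ 3.
Proof.
move=> a0 b0 bt; have t0 : 0 <= t by apply: le_trans bt; exact: sqr_ge0.
have : Num.sqrt (t + a) ^+ 2 = Num.sqrt t ^+ 2 + a.
  by rewrite !sqr_sqrtr// addr_ge0.
have bs : b <= Num.sqrt t by rewrite -(ger0_norm b0) -sqrtr_sqr ler_wsqrtr.
move: bs (sqrtr_ge0 (t + a)) (sqrtr_ge0 t).
set r := Num.sqrt (_ + _); set s := Num.sqrt _ => bs r0 s0 rsa.
have -> : r ^+ 3 - s ^+ 3 =
  3 / 2 * s * (r ^+ 2 - s ^+ 2) + (r - s) ^+ 2 * (r + s / 2) by field.
have : 0 <= (r - s) ^+ 2 * (r + s / 2).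
  by rewrite mulr_ge0 ?sqr_ge0// addr_ge0// divr_ge0.
have : b * a <= s * a by rewrite ler_wpM2r.
by rewrite rsa [s ^+ 2 + _]addrC addrK -!mulrA (mulrC a); lra.
Qed.

Definition density k u : R := u ^+ k * expR (- (2 * h u)).

Lemma density_ge0 k u : 0 <= u -> 0 <= density k u.
Proof. by move=> u0; rewrite mulr_ge0 ?exprn_ge0 ?expR_ge0. Qed.

Lemma density_expR k t :
  density k (expR t) = expR (k%:R * t - Num.sqrt t ^+ 3).
Proof.
by rewrite expRB expRM_natl -expRN; congr (_ * expR (- _)); exact: h_expR.
Qed.

(** In the exponent, dilation by [expR a] with its factor [expR a ^+ p] adds [(k + p) * a]; by
    hypothesis this exceeds the growth of the cubic term by at least [b]. *)
Lemma density_scale_le k p t a b :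
  Num.sqrt (t + a) ^+ 3 - Num.sqrt t ^+ 3 <= (k + p)%:R * a - b ->
  density k (expR t) <=
    expR (- b) * (expR a ^+ p * density k (expR a * expR t)).
Proof.
rewrite -(expRD a t) (addrC a t) !density_expR -expRM_natl -!expRD ler_expR.
by rewrite natrD; lra.
Qed.

(** With [q = 2 m + 2], the linear term has slope [q], while [t^(3/2)] has slope [q - 1/2] or
    [q + 1/2] at the moved window ends. Dilation by [e^a] towards the peak thus saves at least
    [|a| / 2], and [2/9 * (2 m + 1)] is below [|a| / 2] for both scales. *)
Definition gain m : R := expR (- (2 / 9 * (2 * m%:R + 1))).

(* On the logarithmic scale [density k] peaks at [4/9 * q^2], with
   [q = 2 m + 2], and the window ends at [4/9 * (q - 1)^2] and
   [4/9 * (q + 1)^2]. These factors move the ends to [4/9 * (q - 1/2)^2] and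
   [4/9 * (q + 1/2)^2], half way to the peak. *)
Definition scale_in m : R := expR (4 / 9 * (2 * m%:R + 5 / 4)).
Definition scale_out m : R := expR (- (4 / 9 * (2 * m%:R + 11 / 4))).

Lemma density_lt_Rad_prev k p m u : (0 < k)%N -> (k + p = 2 * m + 2)%N ->
  0 <= u < Rad_prev m ->
  density k u <= gain m * (scale_in m ^+ p * density k (scale_in m * u)).
Proof.
(* The point [u = 0] has no logarithm; the density vanishes there because [k > 0]. *)
move=> k0 kp /andP[]; rewrite le_eqVlt => /predU1P[<- _|u0 um].
  by rewrite mulr0 /density expr0n eqn0Ngt k0 !(mul0r, mulr0).
case: m kp um => [|m] kp /=; first by rewrite ltNge (ltW u0).
rewrite -(@lnK _ u) ?posrE// ltr_expR /gain /scale_in.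
move: (ln u) => t um.
have mR : (m.+1%:R : R) = m%:R + 1 by rewrite -addn1 natrD.
have m0 : 0 <= m%:R :> R by [].
have {}um : t < 4 / 9 * (2 * m%:R + 3) ^+ 2.
  by rewrite (lt_le_trans um)// natrD natrM.
apply: density_scale_le; rewrite kp natrD natrM !mR.
(* The index is now [m.+1], so [q = 2 m + 4] and [b ^+ 2] is the moved end [4/9 * (q - 1/2)^2]. *)
set a := 4 / 9 * _; set b : R := 2 / 3 * (2 * m%:R + 7 / 2).
apply: (@le_trans _ _ (3 / 2 * a * b)).
  apply: sqrtr_cube_leD; rewrite /a /b; [lra|lra|].
  have -> : (2 / 3 * (2 * m%:R + 7 / 2)) ^+ 2 =
    4 / 9 * (2 * m%:R + 3) ^+ 2 + 4 / 9 * (2 * (m%:R + 1) + 5 / 4) :> R by field.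
  by rewrite lerD2r ltW.
rewrite /a /b; set M : R := m%:R.
have -> : 3 / 2 * (4 / 9 * (2 * (M + 1) + 5 / 4)) * (2 / 3 * (2 * M + 7 / 2)) =
  (2 * (M + 1) + 2) * (4 / 9 * (2 * (M + 1) + 5 / 4)) -
  2 / 9 * (2 * (M + 1) + 5 / 4) by field.
by lra.
Qed.

Lemma density_ge_Rad k p m u : (k + p = 2 * m + 2)%N -> Rad m <= u ->
  density k u <= gain m * (scale_out m ^+ p * density k (scale_out m * u)).
Proof.
move=> kp um; have u0 : 0 < u by apply: lt_le_trans um; exact: expR_gt0.
move: um; rewrite -(@lnK _ u) ?posrE// ler_expR /gain /scale_out.
move: (ln u) => t um.
have m0 : 0 <= m%:R :> R by [].
have {}um : 4 / 9 * (2 * m%:R + 3) ^+ 2 <= t.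
  by rewrite (le_trans _ um)// natrD natrM.
apply: density_scale_le; rewrite kp natrD natrM.
set a := 4 / 9 * _; set b : R := 2 / 3 * (2 * m%:R + 5 / 2).
(* The dilation goes down, so convexity is applied to the increment from [t - a] up to [t]. *)
rewrite -[X in _ - Num.sqrt X ^+ 3](subrK a) mulrN -opprD -lerN2 opprB opprK.
apply: (@le_trans _ _ (3 / 2 * a * b)); last first.
  apply: sqrtr_cube_geD; rewrite /a /b; [lra|lra|].
  have -> : (2 / 3 * (2 * m%:R + 5 / 2)) ^+ 2 =
    4 / 9 * (2 * m%:R + 3) ^+ 2 - 4 / 9 * (2 * m%:R + 11 / 4) :> R by field.
  by rewrite lerD2r.
rewrite /a /b; set M : R := m%:R.
have -> : 3 / 2 * (4 / 9 * (2 * M + 11 / 4)) * (2 / 3 * (2 * M + 5 / 2)) =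
  (2 * M + 2) * (4 / 9 * (2 * M + 11 / 4)) +
  2 / 9 * (2 * M + 11 / 4) by field.
rewrite lerD2l; have : 0 <= M by [].
by lra.
Qed.

End radial_weight.

(** * The symbol as a sign on windows, and its pointwise deviation from [(-1)^m] *)

Section radial_symbol.
Context {R : realType}.
Implicit Types (u : R) (k p m : nat).

(** The radii are unbounded, and minimality of [m] with [u < Rad m] gives the left inequality. *)
Lemma Rad_window u : 0 <= u -> exists m, Rad_prev m <= u < Rad m.
Proof.
move=> u0; have ex : exists m, u < Rad m.
  exists (Num.bound u); apply: lt_le_trans (expR_ge1Dx _).
  have := archi_boundP u0; set n := Num.bound u => un.
  rewrite (lt_le_trans un)// natrD natrM.
  have : 0 <= n%:R :> R by [].
  by nra.
have [m um mmin] := ex_minnP ex; exists m; rewrite um andbT.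
case: m um mmin => [//|m] um mmin /=; rewrite leNgt; apply/negP => /mmin.
by rewrite ltnn.
Qed.

Definition phi_abs u : R := complex.Re (phi u%:C%C).

Lemma normcC u : normc u%:C%C = `|u|.
Proof. by rewrite /normc/= expr0n addr0 sqrtr_sqr. Qed.

Lemma phi_absE m u : Rad_prev m <= u < Rad m -> phi_abs u = (-1) ^+ m.
Proof.
move=> um; have u0 : 0 <= u.
  case/andP: um => + _; apply: le_trans.
  by case: m => [|m]//=; exact: expR_ge0.
rewrite /phi_abs (@phiE _ m) ?normcC ?ger0_norm//.
by rewrite -signr_odd -[in RHS]signr_odd; case: (odd m).
Qed.

Lemma phi_norm (z : R[i]) : phi z = (phi_abs (normc z))%:C%C.
Proof.
have z0 : 0 <= normc z by case: z => a b; exact: sqrtr_ge0.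
have [m zm] := Rad_window _ z0.
rewrite (phiE zm) (phi_absE _ _ zm).
by rewrite -signr_odd -[in RHS]signr_odd; case: (odd m); rewrite ?expr0 ?expr1 ?rmorphN.
Qed.

Lemma normr_phi_abs u : 0 <= u -> `|phi_abs u| = 1.
Proof. by move=> /Rad_window[m /phi_absE ->]; rewrite normr_sign. Qed.

(** A preimage is a countable union of windows; these cover [[0, +oo[], hence the domain. *)
Lemma measurable_phi_abs : measurable_fun (`[0, +oo[ : set R) phi_abs.
Proof.
move=> _ Y mY.
have -> : `[0, +oo[ `&` phi_abs @^-1` Y =
    \bigcup_(m in [set m | Y ((-1) ^+ m)]) `[Rad_prev m, Rad m[%classic.
  apply/seteqP; split=> [u [/=]|u [m /= Ym]].
    rewrite in_itv/= andbT => /Rad_window[m um] Yu.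
    by exists m => //=; rewrite -?(phi_absE _ _ um)// in_itv.
  rewrite !in_itv/= => um; rewrite (phi_absE _ _ um); split=> //.
  rewrite andbT; case/andP: um => + _; apply: le_trans.
  by case: m {Ym} => [|m]//=; exact: expR_ge0.
by apply: bigcup_measurable => m _; exact: measurable_itv.
Qed.

Lemma measurable_density k : measurable_fun setT (@density R k).
Proof.
apply: measurable_funM; first exact: exprn_measurable.
apply: measurableT_comp => //; apply: measurableT_comp => //.
apply: measurable_funM => //; apply: measurable_fun_ifT => //.
  exact: measurable_fun_ler.
apply: measurable_funM => //.
exact: (measurableT_comp (@measurable_powR _ _) (@measurable_ln _)).
Qed.

(** The deviation vanishes on the window and is at most 2 elsewhere; [X] and [Y] stand for the
    dilated bounds on the inner and outer sides. *)
Lemma phi_abs_sub_le m u (d X Y : R) :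
  0 <= u -> 0 <= d -> 0 <= X -> 0 <= Y ->
  (u < Rad_prev m -> d <= X) -> (Rad m <= u -> d <= Y) ->
  `|(phi_abs u - (-1) ^+ m) * d| <= 2 * (X + Y).
Proof.
move=> u0 d0 X0 Y0 dX dY; rewrite normrM (ger0_norm d0).
have dist : `|phi_abs u - (-1) ^+ m| <= 2.
  by rewrite (le_trans (ler_normB _ _))// normr_phi_abs// normr_sign.
have {}dist : `|phi_abs u - (-1) ^+ m| * d <= 2 * d by rewrite ler_wpM2r.
have [/dX {}dX|mu] := ltP u (Rad_prev m).
  by rewrite (le_trans dist)// ler_pM2l// (le_trans dX)// lerDl.
have [um|/dY {}dY] := ltP u (Rad m); last first.
  by rewrite (le_trans dist)// ler_pM2l// (le_trans dY)// lerDr.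
rewrite (phi_absE m u) ?mu// subrr normr0 mul0r.
by rewrite mulr_ge0// addr_ge0.
Qed.

(** Both dilated densities appear at every [u], so the bound integrates over the whole domain
    without cutting it at the radii. *)
Lemma phi_abs_density_le k p m u :
  (0 < k)%N -> (k + p = 2 * m + 2)%N -> 0 <= u ->
  `|(phi_abs u - (-1) ^+ m) * density k u| <= 2 * gain m *
    (scale_in m ^+ p * density k (scale_in m * u) +
     scale_out m ^+ p * density k (scale_out m * u)).
Proof.
move=> k0 kp u0; rewrite -mulrA (mulrDr (gain m)).
have P c : 0 <= c -> 0 <= c ^+ p * density k (c * u).
  move=> c0; apply: mulr_ge0; first exact: exprn_ge0.
  by apply: density_ge0; exact: mulr_ge0.
apply: phi_abs_sub_le => //; first exact: density_ge0.
- by apply: mulr_ge0; [|apply: P]; exact: expR_ge0.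
- by apply: mulr_ge0; [|apply: P]; exact: expR_ge0.
- by move=> um; apply: density_lt_Rad_prev => //; apply/andP.
- by move=> mu; exact: density_ge_Rad.
Qed.

End radial_symbol.

(** * Scaling of Lebesgue measure on the line and on the plane *)

Section dilation.
Context {R : realType}.
Implicit Types (c : R).
Local Open Scope ereal_scope.
Local Notation mu := (@lebesgue_measure R).

(** The scaling hypothesis says that [nu] is [c] times its image under [S]. *)
Lemma ge0_integral_homothety d (T : measurableType d)
    (nu : {measure set T -> \bar R}) (S : T -> T) c (f : T -> \bar R) :
  measurable_fun setT S -> (0 <= c)%R ->
  (forall A, measurable A -> nu A = c%:E * nu (S @^-1` A)) ->
  measurable_fun setT f -> (forall x, 0 <= f x) ->
  \int[nu]_x f x = c%:E * \int[nu]_x f (S x).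
Proof.
move=> mS c0 nuS mf f0.
rewrite (eq_measure_integral (mscale (NngNum c0) (pushforward nu S))); last first.
  by move=> A mA _; exact: nuS.
by rewrite ge0_integral_mscale// ge0_integral_pushforward.
Qed.

Lemma preimage_mulr_itvoc c (a b : R) : (0 < c)%R ->
  ( *%R c) @^-1` `]a, b]%classic = `](c^-1 * a)%R, (c^-1 * b)%R]%classic.
Proof.
move=> c0; apply/seteqP; split=> x /=; rewrite !in_itv/=;
  by rewrite ltr_pdivrMl// ler_pdivlMl.
Qed.

Lemma lebesgue_measure_dilation c (A : set R) : (0 < c)%R -> measurable A ->
  mu A = c%:E * mu (( *%R c) @^-1` A).
Proof.
move=> c0 mA; pose c' : {nonneg R} := NngNum (ltW c0).
(* By uniqueness, it suffices to compare the two measures on half-open intervals. *)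
rewrite (@lebesgue_measure_unique _
  (mscale c' (pushforward mu ( *%R c : _ -> measurableTypeR R))))//.
move=> _ [[a b] _ <-].
rewrite -[RHS]/(c%:E * mu ( *%R c @^-1` `]a, b]%classic)).
rewrite (preimage_mulr_itvoc _ a b c0).
rewrite !lebesgue_measure_itv/= !lte_fin ltr_pM2l ?invr_gt0//.
case: ifPn => _; last by rewrite mule0.
by rewrite -!EFinB -EFinM -mulrBr mulVKf ?gt_eqF.
Qed.

Definition dilate c (x : measurableTypeR R * measurableTypeR R) :
  measurableTypeR R * measurableTypeR R := (c * x.1, c * x.2)%R.

Lemma measurable_dilate c : measurable_fun setT (dilate c).
Proof.
by apply/measurable_fun_pairP; split;
  apply: (measurableT_comp (mulrl_measurable _)).
Qed.

Lemma area_dilate c A : (0 < c)%R -> measurable A ->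
  area A = (c ^+ 2)%:E * area (dilate c @^-1` A).
Proof.
move=> c0 mA; pose c2 : {nonneg R} := NngNum (sqr_ge0 c).
have md := measurable_dilate c.
(* Rectangles determine the product measure, and each side contributes one factor [c]. *)
rewrite /area/= (@product_measure_unique _ _ _ _ _ mu mu
  (mscale c2 (pushforward area (dilate c))))// => {}A B {}mA mB.
rewrite -[LHS]/((c ^+ 2)%:E * (mu \x mu) (( *%R c @^-1` A) `*` ( *%R c @^-1` B))).
have mX X : measurable X -> measurable ( *%R c @^-1` X : set (measurableTypeR R)).
  by move=> mX; rewrite -[X in measurable X]setTI; exact: mulrl_measurable.
rewrite product_measure1E; [|exact: mX|exact: mX].
rewrite -[RHS]/(mu A * mu B) (lebesgue_measure_dilation _ _ c0 mA).
rewrite (lebesgue_measure_dilation _ _ c0 mB).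
by rewrite muleACA -EFinM -expr2.
Qed.

End dilation.

(** * Concentration of the mass on the window *)

Section concentration.
Context {d} {T : measurableType d} {R : realType}.
Variables (nu : {measure set T -> \bar R}) (D : set T) (N : T -> R).
Variables (k p m : nat).
Hypotheses (mD : measurable D) (mN : measurable_fun D N).
Hypothesis N0 : forall x, D x -> 0 <= N x.
Hypotheses (k0 : (0 < k)%N) (kp : (k + p = 2 * m + 2)%N).
(** Used with [p = 1] and [N] the identity on the half-line, and with [p = 2] and [N] the modulus on
    the plane. *)
Hypothesis homogeneous : forall c : R, 0 < c ->
  (\int[nu]_(x in D) (c ^+ p * density k (c * N x))%:E =
   \int[nu]_(x in D) (density k (N x))%:E)%E.
Hypothesis finite : (\int[nu]_(x in D) (density k (N x))%:E < +oo)%E.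

Let measurable_density_dilated c :
  measurable_fun D (fun x => c ^+ p * density k (c * N x)).
Proof.
apply: measurable_funM => //.
apply: (measurableT_comp (@measurable_density _ _)).
exact: measurable_funM.
Qed.

Let integrable_density_dilated c : 0 < c ->
  nu.-integrable D (EFin \o (fun x => c ^+ p * density k (c * N x))).
Proof.
move=> c0; apply/integrableP; split.
  exact/measurable_EFinP/measurable_density_dilated.
rewrite (_ : integral _ _ _ =
    \int[nu]_(x in D) (c ^+ p * density k (c * N x))%:E)%E.
  by rewrite homogeneous.
apply: eq_integral => x; rewrite inE => /N0 Nx.
rewrite /= ger0_norm// mulr_ge0 ?exprn_ge0 ?(ltW c0)//.
by apply: density_ge0; exact: mulr_ge0 (ltW c0) Nx.
Qed.

Lemma integrable_density : nu.-integrable D (EFin \o (density k \o N)).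
Proof.
apply: eq_integrable (integrable_density_dilated _ ltr01) => // x _.
by rewrite /= expr1n !mul1r.
Qed.

Lemma integrable_phi_density :
  nu.-integrable D (EFin \o (fun x => phi_abs (N x) * density k (N x))).
Proof.
apply: le_integrable integrable_density => //.
  apply/measurable_EFinP/measurable_funM.
    apply: measurable_comp (measurable_phi_abs) mN => //.
    by move=> _ [x Dx <-]; rewrite /= in_itv/= N0.
  exact: (measurableT_comp (@measurable_density _ _)).
by move=> x /N0 Nx; rewrite /= lee_fin normrM normr_phi_abs// mul1r.
Qed.

(** Each of the two dilated densities integrates to [J], so the pointwise bound gives
    [2 * gain m * (J + J)]. *)
Lemma concentration (J := \int[nu]_(x in D) density k (N x)) :
  `|\int[nu]_(x in D) (phi_abs (N x) * density k (N x)) - (-1) ^+ m * J|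
    <= 4 * gain m * J.
Proof.
have := fun (u : R) u0 => phi_abs_density_le k p m u k0 kp u0.
have : 0 < @scale_out R m by exact: expR_gt0.
have : 0 < @scale_in R m by exact: expR_gt0.
move: (@scale_in R m) (@scale_out R m) (@gain R m) => ci co g ci0 co0 le_g.
have Ji c : 0 < c -> \int[nu]_(x in D) (c ^+ p * density k (c * N x)) = J.
  by move=> c0; congr fine; exact: homogeneous.
rewrite -RintegralZl//; last exact: integrable_density.
have iZ : nu.-integrable D (EFin \o (fun x => (-1) ^+ m * density k (N x))).
  exact: (integrableZl mD _ integrable_density).
rewrite -RintegralB//; last exact: integrable_phi_density.
have iB := integrableB mD integrable_phi_density iZ.
apply: le_trans (le_normr_Rintegral mD iB) _.
have iD := integrableD mD (integrable_density_dilated _ ci0)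
  (integrable_density_dilated _ co0).
apply: (@le_trans _ _ (\int[nu]_(x in D) (2 * g *
    (ci ^+ p * density k (ci * N x) + co ^+ p * density k (co * N x))))).
  apply: le_Rintegral => //.
  - exact: (integrable_abse iB).
  - exact: (integrableZl mD _ iD).
  - by move=> x /N0 Nx; have := le_g _ Nx; rewrite mulrBl.
rewrite RintegralZl//.
rewrite RintegralD; [|by []|exact: integrable_density_dilated|
  exact: integrable_density_dilated].
apply: (@le_trans _ _ (2 * g * (J + J))); last by clearbody J; lra.
by rewrite le_eqVlt; apply/orP; left; apply/eqP; congr (_ * (_ + _)); exact: Ji.
Qed.

(** A zero integral would make the density vanish almost everywhere on [D], yet it is positive on
    [A]. *)
Lemma density_integral_gt0 A : measurable A -> A `<=` D ->
  (forall x, A x -> 0 < N x) -> nu A != 0%E ->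
  0 < \int[nu]_(x in D) density k (N x).
Proof.
move=> mA AD NA A0; rewrite lt_neqAle Rintegral_ge0 ?andbT; last first.
  by move=> x /N0; exact: density_ge0.
apply/negP => /eqP /esym J0; case/eqP: A0; apply/negligibleP => //.
have : (\int[nu]_(x in D) `|(EFin \o (density k \o N)) x| = 0)%E.
  transitivity (\int[nu]_(x in D) (density k (N x))%:E)%E.
    by apply: eq_integral => x; rewrite inE => /N0 Nx; rewrite /= ger0_norm ?density_ge0.
  by rewrite -[LHS]fineK ?integrable_fin_num//; [exact: congr1 J0|exact: integrable_density].
move=> /(ae_eq_integral_abs nu mD (measurable_int _ integrable_density)).
apply: negligibleS => x Ax /= /(_ (AD _ Ax)) /eqP; apply/negP.
have Nx := NA _ Ax.
by rewrite eqe /density mulf_neq0// ?gt_eqF ?exprn_gt0 ?expR_gt0.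
Qed.

End concentration.

(** * Finiteness and dilation invariance of the integrals; decay of the error *)

Section instances.
Context {R : realType}.
Local Notation mu := (@lebesgue_measure R).
Local Notation plane := (measurableTypeR R * measurableTypeR R)%type.

(** For [u > 1], with [s = sqrt (ln u)] and [K = k + 2], the density times [u^2] is
    [exp (s^2 * (K - s))], whose exponent is at most [K^3]. The factor 2 comes from
    [1 + u^2 <= 2 * max(1, u^2)]. *)
Lemma density_le k (u : R) : 0 <= u ->
  density k u <= 2 * expR (k.+2%:R ^+ 3) * (oneDsqr u)^-1.
Proof.
move=> u0; rewrite ler_pdivlMr; last by rewrite /oneDsqr ltr_pwDl// sqr_ge0.
have [u1|u1] := leP u 1.
  have d1 : density k u <= 1.
    rewrite /density /h u1 mulr0 oppr0 expR0 mulr1.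
    by rewrite exprn_ile1.
  have e1 : 1 <= expR (k.+2%:R ^+ 3) :> R.
    by rewrite -[leLHS]expR0 ler_expR exprn_ge0.
  have o2 : oneDsqr u <= 2 by rewrite /oneDsqr; nra.
  apply: (@le_trans _ _ (1 * 2)); last lra.
  by rewrite ler_pM ?density_ge0.
have o2 : oneDsqr u <= 2 * u ^+ 2 by rewrite /oneDsqr; nra.
apply: (@le_trans _ _ (density k u * (2 * u ^+ 2))).
  by rewrite ler_wpM2l// density_ge0.
rewrite mulrCA ler_pM2l//.
have uE : u = expR (ln u) by rewrite lnK// posrE; lra.
have t0 : 0 <= ln u by rewrite ln_ge0// ltW.
rewrite uE; move: (ln u) t0 => t t0.
rewrite density_expR -expRM_natl -expRD ler_expR.
have -> : k%:R * t - Num.sqrt t ^+ 3 + 2%:R * t =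
    Num.sqrt t ^+ 2 * (k.+2%:R - Num.sqrt t).
  by rewrite exprSr sqr_sqrtr// -(addn2 k) natrD; ring.
have s0 := sqrtr_ge0 t; move: (Num.sqrt t) s0 => s s0.
have K0 : 0 <= k.+2%:R :> R by [].
move: (k.+2%:R : R) K0 => K K0.
have [sK|Ks] := leP s K; last first.
  apply: (@le_trans _ _ 0); last exact: exprn_ge0.
  by rewrite mulr_ge0_le0 ?sqr_ge0// subr_le0 ltW.
rewrite [K ^+ 3]exprSr; apply: ler_pM; rewrite ?sqr_ge0 ?subr_ge0//.
  by rewrite ler_pXn2r// nnegrE.
by rewrite gerBl.
Qed.

Lemma density_integral_lty k :
  (\int[mu]_(u in `[0%R, +oo[) (density k u)%:E < +oo)%E.
Proof.
set C : R := 2 * expR (k.+2%:R ^+ 3).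
apply: (@le_lt_trans _ _
    (\int[mu]_(u in `[0%R, +oo[) (C%:E * (oneDsqr u)^-1%:E))%E).
  apply: ge0_le_integral => //.
  - by move=> u /=; rewrite in_itv/= andbT => u0; rewrite lee_fin density_ge0.
  - apply/measurable_EFinP; apply: measurable_funTS.
    exact: measurable_density.
  - apply: measurable_funTS; apply/measurable_EFinP/measurable_funM => //.
    by apply: continuous_measurable_fun; exact: continuous_oneDsqrV.
  - move=> u /=; rewrite in_itv/= andbT => u0.
    by rewrite -EFinM lee_fin density_le.
rewrite ge0_integralZl//.
- by rewrite integral0y_oneDsqr -EFinM ltry.
- apply: measurable_funTS; apply/measurable_EFinP.
  by apply: continuous_measurable_fun; exact: continuous_oneDsqrV.
- by rewrite lee_fin mulr_ge0// expR_ge0.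
Qed.

Lemma density_dilation_line k (c : R) : 0 < c ->
  (\int[mu]_(u in `[0%R, +oo[) (c ^+ 1 * density k (c * u))%:E =
   \int[mu]_(u in `[0%R, +oo[) (density k u)%:E)%E.
Proof.
(* Extension by zero to the whole line is compatible with dilation, as [c > 0] preserves the
   half-line. *)
move=> c0; rewrite integral_mkcond [RHS]integral_mkcond.
set f := (X in integral _ _ X = _); set g := (X in _ = integral _ _ X).
have g0 x : (0 <= g x)%E.
  rewrite /g patchE; case: ifPn => //; rewrite inE/= in_itv/= andbT => x0.
  by rewrite lee_fin density_ge0.
have mg : measurable_fun setT g.
  apply/(measurable_restrictT _ _).1 => //.
  apply/measurable_EFinP; apply: measurable_funTS.
  exact: measurable_density.
have fg (x : R) : f x = (c%:E * g (c * x)%R)%E.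
  rewrite /f /g !patchE !mem_setE !in_itv/= !andbT.
  by rewrite pmulr_rge0//; case: ifPn => _; rewrite ?mule0// expr1.
clearbody f g; transitivity (\int[mu]_x (c%:E * g (c * x)%R))%E.
  by apply: eq_integral => x _; exact: fg.
rewrite ge0_integralZl//; last 2 first.
- by apply: measurableT_comp => //; exact: mulrl_measurable.
- by rewrite lee_fin ltW.
rewrite [RHS](@ge0_integral_homothety R _ _ mu ( *%R c) c)//.
- exact: ltW.
- by move=> A mA; exact: lebesgue_measure_dilation.
Qed.

Definition modulus (x : plane) : R := normc (x.1 +i* x.2)%C.

Lemma modulus_ge0 x : 0 <= modulus x.
Proof. exact: sqrtr_ge0. Qed.

Lemma measurable_modulus : measurable_fun setT modulus.
Proof.
apply: (measurableT_comp (continuous_measurable_fun (@sqrt_continuous R))).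
by apply: measurable_funD; apply: measurable_funX.
Qed.

Lemma modulus_dilate (c : R) x : 0 <= c -> modulus (dilate c x) = c * modulus x.
Proof.
move=> c0; rewrite /modulus /= !exprMn -mulrDr sqrtrM ?sqr_ge0//.
by rewrite sqrtr_sqr ger0_norm.
Qed.

Lemma density_dilation_plane k (c : R) : 0 < c ->
  (\int[area]_x (c ^+ 2 * density k (c * modulus x))%:E =
   \int[area]_x (density k (modulus x))%:E)%E.
Proof.
move=> c0.
set f := (X in integral _ _ X = _); set g := (X in _ = integral _ _ X).
have mg : measurable_fun setT g.
  apply/measurable_EFinP.
  exact: measurableT_comp (@measurable_density _ _) measurable_modulus.
have g0 x : (0 <= g x)%E by rewrite lee_fin density_ge0// modulus_ge0.
have fg x : f x = ((c ^+ 2)%:E * g (dilate c x))%E.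
  by rewrite /f /g -EFinM modulus_dilate// ltW.
clearbody f g; transitivity (\int[area]_x ((c ^+ 2)%:E * g (dilate c x)))%E.
  by apply: eq_integral => x _; exact: fg.
rewrite ge0_integralZl//; last 2 first.
- by apply: (measurableT_comp mg); exact: measurable_dilate.
- by rewrite lee_fin sqr_ge0.
rewrite [RHS](@ge0_integral_homothety R _ _ area (dilate c) (c ^+ 2))//.
- exact: measurable_dilate.
- exact: sqr_ge0.
- by move=> A mA; exact: area_dilate.
Qed.

(** Restricted to [0 < m] because on the plane the exponent [k = 2 * m] has to be positive. *)
Lemma gain_cvg0 (x : nat -> R) :
  (forall m, (0 < m)%N -> 0 <= x m <= 4 * gain m) -> x m @[m --> \oo] --> (0 : R).
Proof.
move=> xg; apply: (@squeeze_cvgr _ _ _ _ (cst 0) (fun m => 9 * harmonic m)).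
- near=> m; have m0 : (0 < m)%N by near: m; exists 1%N.
  have /andP[-> /=] := xg _ m0; move/le_trans; apply.
  have m0' : 0 <= m%:R :> R by [].
  rewrite /harmonic /gain expRN ler_pdivlMr// mulrAC ler_pdivrMr ?expR_gt0//.
  (* From [1 + x <= e^x]: 9 clears the denominator, and [4 * (m + 1) <= 4 * m + 11]. *)
  apply: (@le_trans _ _ (9 * (1 + 2 / 9 * (2 * m%:R + 1)))).
    by rewrite -(addn1 m) natrD; lra.
  by rewrite ler_pM2l// expR_ge1Dx.
- exact: cvg_cst.
- by rewrite -[X in _ --> X](mulr0 9); apply: cvgMl_tmp; exact: cvg_harmonic.
Unshelve. all: by end_near. Qed.

End instances.

(** * The integral formula and the eigenvalues of the operator *)

Section eigenvalues.
Context {R : realType}.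
Local Notation mu := (@lebesgue_measure R).
Local Notation plane := (measurableTypeR R * measurableTypeR R)%type.

Lemma dist_le_of_mul (a s J g : R) :
  0 < J -> `|a * J - s * J| <= g * J -> `|a - s| <= g.
Proof. by move=> J0; rewrite -mulrBl normrM (gtr0_norm J0) ler_pM2r. Qed.

Lemma lebesgue_measure_itv12 : mu `[1, 2]%classic = 1%:E.
Proof.
rewrite lebesgue_measure_itv/= lte_fin ltr1n -EFinB.
by congr EFin; lra.
Qed.

Lemma lambda_dist m :
  normc (lambda (@h R) phi m - (-1) ^+ m) <= 4 * gain m.
Proof.
pose D : set R := `[0, +oo[%classic; pose k := (2 * m + 1)%N.
have mD : measurable D by exact: measurable_itv.
have D0 u : D u -> 0 <= u by rewrite /D/= in_itv/= andbT.
have mN : measurable_fun D (@idfun R) by exact: measurable_id.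
have k0 : (0 < k)%N by rewrite /k addn_gt0 orbT.
have kp : (k + 1 = 2 * m + 2)%N by rewrite /k -addnA.
have hom := @density_dilation_line R k.
have fin := @density_integral_lty R k.
set J := \int[mu]_(u in D) density k u.
have J0 : 0 < J.
  (* Any set of positive measure away from 0 would do as witness. *)
  apply: (density_integral_gt0 mu D (@idfun R) k 1 mD mN D0 hom fin `[1, 2]%classic).
  - exact: measurable_itv.
  - by move=> u; rewrite /D/= !in_itv/= => /andP[u1 _]; rewrite andbT; lra.
  - by move=> u /=; rewrite in_itv/= => /andP[u1 _]; lra.
  - apply/eqP => A0; have := etrans (esym lebesgue_measure_itv12) A0.
    by move=> /eqP; rewrite eqe oner_eq0.
have := concentration mu D (@idfun R) k 1 m mD mN D0 k0 kp hom fin.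
rewrite -/J; set I := Rintegral _ _ _ => IJ.
have -> : lambda (@h R) phi m = (I / J)%:C%C.
  rewrite /lambda -/J /cintegral.
  have E u : D u -> phi u%:C%C * (u ^+ (2 * m + 1) * expR (- (2 * h u)))%:C%C =
      (phi_abs u * density k u)%:C%C.
    by move=> /D0 u0; rewrite phi_norm normcC ger0_norm// -rmorphM.
  have -> : \int[mu]_(u in D) complex.Re (phi u%:C%C *
      (u ^+ (2 * m + 1) * expR (- (2 * h u)))%:C%C) = I.
    by apply: eq_Rintegral => u; rewrite inE => Du; rewrite E.
  have -> : \int[mu]_(u in D) complex.Im (phi u%:C%C *
      (u ^+ (2 * m + 1) * expR (- (2 * h u)))%:C%C) = 0.
    transitivity (\int[mu]_(u in D) (0 : R)); last first.
      by rewrite Rintegral_cst// mul0r.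
    by apply: eq_Rintegral => u; rewrite inE => Du; rewrite E.
  by rewrite rmorphM fmorphV.
have -> : (-1) ^+ m = ((-1) ^+ m)%:C%C :> R[i] by rewrite rmorphXn rmorphN1.
rewrite -rmorphB normcC; apply: (dist_le_of_mul _ _ _ _ J0).
by rewrite divfK// gt_eqF.
Qed.

Lemma normcX (z : R[i]) n : normc (z ^+ n) = normc z ^+ n.
Proof.
by elim: n => [|n IHn]; rewrite ?expr0 ?normc1// !exprS normcM IHn.
Qed.

Lemma mul_conjc (z : R[i]) : z * conjc z = (normc z ^+ 2)%:C%C.
Proof.
case: z => a b; rewrite /normc sqr_sqrtr ?addr_ge0 ?sqr_ge0//.
apply/eqP; rewrite eq_complex /=.
by rewrite !mulrN opprK -!expr2 mulrC addNr !eqxx.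
Qed.

(** Orthogonality of [phi z^m - c z^m] to [z^m] itself forces [c = I / J], with [I] and [J] plane
    integrals of the density of exponent [2 * m] in the modulus. *)
Lemma toeplitz_scalar_dist m (c : R[i]) : (0 < m)%N ->
  toeplitz_scalar (@h R) phi m c -> normc (c - (-1) ^+ m) <= 4 * gain m.
Proof.
move=> m0; pose f z : R[i] := z ^+ m; pose k := (2 * m)%N.
have fm : monomials m f by exists 1; apply/funext => z; rewrite mul1r.
move=> /(_ f fm)[Af [_ _ /(_ f Af)]]; have [_ [_ ff]] := Af.
have k0 : (0 < k)%N by rewrite muln_gt0.
have kp : (k + 2 = 2 * m + 2)%N by [].
have hom := @density_dilation_plane R k.
have mN := @measurable_modulus R.
have mT := @measurableT _ plane.
have N0 (x : plane) : setT x -> 0 <= modulus x by move=> _; exact: modulus_ge0.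
(* This integral is the squared norm of [z^m], finite since [toeplitz] places [f] in [Ah]. *)
have fin : (\int[@area R]_x (density k (modulus x))%:E < +oo)%E.
  apply: le_lt_trans ff; rewrite le_eqVlt; apply/orP; left; apply/eqP.
  apply: eq_integral => x _; congr EFin.
  by rewrite /onplane /f normcX -exprM mulnC.
have := concentration area setT modulus k 2 m mT mN N0 k0 kp hom fin.
have J0 : 0 < \int[@area R]_x density k (modulus x).
  apply: (density_integral_gt0 area setT modulus k 2 mT mN N0 hom fin
    (`[1, 2]%classic `*` `[1, 2]%classic)) => //.
  - by apply: measurableX; exact: measurable_itv.
  - move=> [a b] [/=]; rewrite !in_itv/= => /andP[a1 _] _.
    by rewrite /modulus/= sqrtr_gt0 ltr_pwDl ?sqr_ge0// exprn_gt0//; lra.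
  - rewrite /area/= product_measure1E; [|exact: measurable_itv..].
    apply/eqP => A0; move: A0.
    have e := lebesgue_measure_itv12; rewrite -[LHS]/(mu _ * mu _)%E e mule1.
    by move=> /eqP; rewrite eqe oner_eq0.
have iF := integrable_phi_density area setT modulus k 2 mT mN N0 hom fin.
have iJ := integrable_density area setT modulus k 2 mT mN N0 hom fin.
move: iF iJ J0; rewrite /inner_h /cintegral.
have E x : onplane (fun z : R[i] =>
     (phi z * f z - c * f z) * conjc (f z) * (weight (@h R) z)%:C%C) x =
  ((phi_abs (modulus x))%:C%C - c) * (density k (modulus x))%:C%C.
  rewrite /onplane phi_norm -/(modulus x) -mulrBl -!mulrA; congr (_ * _).
  rewrite mulrA mul_conjc normcX -exprM mulnC.
  by rewrite -rmorphM.
set J := Rintegral _ _ (fun x => density k _).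
set I := Rintegral _ _ (fun x => phi_abs _ * _).
move=> iF iJ J0 IJ.
have -> : \int[@area R]_x complex.Re (onplane (fun z : R[i] =>
     (phi z * f z - c * f z) * conjc (f z) * (weight (@h R) z)%:C%C) x) =
   I - complex.Re c * J.
  rewrite -RintegralZl// -RintegralB//; last exact: (integrableZl mT _ iJ).
  apply: eq_Rintegral => x _; rewrite E; case: (c) => a b /=.
  by rewrite mulr0 subr0 mulrBl.
have -> : \int[@area R]_x complex.Im (onplane (fun z : R[i] =>
     (phi z * f z - c * f z) * conjc (f z) * (weight (@h R) z)%:C%C) x) =
   - complex.Im c * J.
  rewrite -RintegralZl//.
  apply: eq_Rintegral => x _; rewrite E; case: (c) => a b /=.
  by rewrite mulr0 !add0r.
(* The real part gives [I = Re c * J]; the imaginary part makes [c] real, as [J > 0]. *)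
case=> /eqP; rewrite subr_eq0 => /eqP IE /eqP.
rewrite mulf_eq0 (gt_eqF J0) orbF oppr_eq0 => /eqP Imc.
have -> : c = (complex.Re c)%:C%C by clear -Imc; case: c Imc => a b /= ->.
have -> : (-1) ^+ m = ((-1) ^+ m)%:C%C :> R[i] by rewrite rmorphXn rmorphN1.
rewrite -rmorphB normcC; apply: (dist_le_of_mul _ _ _ _ J0).
by rewrite -IE.
Qed.

End eigenvalues.

Theorem lemma9p1 (R : realType) :
  (normc (lambda (@h R) phi m - (-1) ^+ m) @[m --> \oo] --> (0 : R)) /\
  (forall lam : nat -> R[i],
     (forall m, toeplitz_scalar (@h R) phi m (lam m)) ->
     normc (lam m - (-1) ^+ m) @[m --> \oo] --> (0 : R)).
Proof.
have n0 (z : R[i]) : 0 <= normc z by case: z => a b; exact: sqrtr_ge0.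
split=> [|lam lamP]; apply: gain_cvg0 => m m0; rewrite n0/=.
- exact: lambda_dist.
- exact: toeplitz_scalar_dist.
Qed.
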